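(* As a $\mathcal D$-module, $\mathrm{gr}^PA$ is not finitely generated.
   Context: Let $f(x)=\sum_{i=0}^{7}\lambda_i x^i\in\mathbb C[x]$ with $\lambda_7=4$ and no multiple roots; put $\lambda_8=0$. $X$ is the compact Riemann surface of genus $3$ of $y^2=f(x)$, with point at infinity $\infty$. Put $du_i=x^{3-i}dx/y$ and $dr_i=\sum_{k=4-i}^{3+i}(k-3+i)\lambda_{k+5-i}\frac{x^k dx}{4y}$ for $i=1,2,3$. Choose a symplectic basis $\{\alpha_j,\beta_j\}$ of $H_1(X,\mathbb Z)$ and set $2\omega_1=(\int_{\alpha_j}du_i)$, $2\omega_2=(\int_{\beta_j}du_i)$, $-2\eta_1=(\int_{\alpha_j}dr_i)$, $-2\eta_2=(\int_{\beta_j}dr_i)$, $\tau=\omega_1^{-1}\omega_2$. Let $\tau\delta'+\delta''$, $\delta',\delta''\in\frac12\mathbb Z^3$, be the Riemann constant with respect to the base point $\infty$. The sigma function $\sigma(u)$, $u={}^t(u_1,u_2,u_3)$, is the holomorphic function on $\mathbb C^3$ such that for all $m_1,m_2\in\mathbb Z^3$, $\sigma(u+2\omega_1m_1+2\omega_2m_2)=(-1)^{{}^tm_1m_2+2({}^t\delta'm_1-{}^t\delta''m_2)}\exp\big({}^t(2\eta_1m_1+2\eta_2m_2)(u+\omega_1m_1+\omega_2m_2)\big)\sigma(u)$, and whose expansion at $0$ is $u_1u_3-u_2^2-\frac13u_1^3u_2+\frac1{45}u_1^6+\sum_{d<-6}f_d(u)$, with $f_d$ a homogeneous polynomial of degree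 $d$ for $\deg u_i=-(2i-1)$. $J(X)=\mathbb C^3/(2\omega_1\mathbb Z^3+2\omega_2\mathbb Z^3)$; $\Theta\subset J(X)$ is the zero divisor of $\sigma$; $A$ is the ring of meromorphic functions on $J(X)$ with poles only on $\Theta$. $\partial_i=\partial/\partial u_i$ and $\mathcal D=\mathbb C[\partial_1,\partial_2,\partial_3]$ acts on $A$. The pole filtration is $A(n)=\{a\in A: a\text{ has poles of order at most }n\text{ on }\Theta\}$, $n\geq 0$, $A(-1)=0$; $\mathrm{gr}^PA=\bigoplus_{n\ge0}A(n)/A(n-1)$. Since $\partial_iA(n)\subset A(n+1)$, $\mathrm{gr}^PA$ is a $\mathcal D$-module with $\partial_i$ mapping $A(n)/A(n-1)$ to $A(n+1)/A(n)$. *)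

(* Defs.v *)
(* MathComp-Analysis; the complex numbers are R[i] for R : realType. *)
From HB Require Import structures.
From mathcomp Require Import all_boot all_order all_algebra.
From mathcomp Require Import complex.
From mathcomp Require Import all_classical all_reals all_analysis.

Set Implicit Arguments.
Unset Strict Implicit.
Unset Printing Implicit Defensive.

Import Order.TTheory GRing.Theory Num.Theory.
Import numFieldNormedType.Exports.

Local Open Scope classical_set_scope.
Local Open Scope ring_scope.
Local Open Scope complex_scope.

(* Packaging R[i] as a numClosedFieldType makes the generic topological and
   normed structures of numeric fields available on it. *)
Definition Cplx (R : realType) : numClosedFieldType := R[i].

Section ComplexCalculus.
Context {R : realType}.
Local Notation C := (Cplx R).

Definition re (z : C) : R := complex.Re z.
Definition im (z : C) : R := complex.Im z.
Definition mkC (a b : R) : C := a +i* b.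

Definition cexp (z : C) : C :=
  mkC (expR (re z) * cos (im z)) (expR (re z) * sin (im z)).

Definition C1_at (g : R -> C) (t : R) : Prop :=
  [/\ \forall s \near t, derivable (re \o g) s 1 /\ derivable (im \o g) s 1,
      {for t, continuous (derive1 (re \o g))}
    & {for t, continuous (derive1 (im \o g))}].

Definition cderiv (g : R -> C) (t : R) : C :=
  mkC (derive1 (re \o g) t) (derive1 (im \o g) t).

Definition cintegral (a b : R) (g : R -> C) : C :=
  mkC (\int[lebesgue_measure]_(t in `[a, b]) re (g t))
      (\int[lebesgue_measure]_(t in `[a, b]) im (g t)).

Definition partial (i : 'I_3) (F : 'cV[C]_3 -> C) : 'cV[C]_3 -> C :=
  fun u => 'D_(delta_mx i 0) F u.

Definition holomorphic (F : 'cV[C]_3 -> C) : Prop :=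
  (forall u, differentiable F u) /\ (forall i, continuous (partial i F)).

Definition intvec (m : 'cV[int]_3) : 'cV[C]_3 := map_mx intr m.

End ComplexCalculus.

(* Singular homology in degree one.  A chain is a finitely supported integer
   function on 1-simplices; a 1-simplex is a continuous function on [0, 1],
   extended arbitrarily to R, and only its values on [0, 1] matter. *)
Section SingularHomology.
Context {R : realType} {T : topologicalType}.

Definition simplex1 (p : R -> T) : Prop := {within `[0, 1], continuous p}.

Definition simplex2 (s : R * R -> T) : Prop :=
  {within [set z : R * R | [/\ 0 <= z.1, 0 <= z.2 & z.1 + z.2 <= 1]],
    continuous s}.

Definition chain_of (p : R -> T) : (R -> T) -> int :=
  fun q => (`[< forall t : R, 0 <= t <= 1 -> p t = q t >] : nat)%:Z.

Definition boundary1 (p : R -> T) : T -> int :=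
  fun x => (`[< p 1 = x >] : nat)%:Z - (`[< p 0 = x >] : nat)%:Z.

Definition boundary2 (s : R * R -> T) : (R -> T) -> int :=
  fun q => chain_of (fun t => s (1 - t, t)) q
           - chain_of (fun t => s (0, t)) q + chain_of (fun t => s (t, 0)) q.

Definition is_cycle (c : (R -> T) -> int) : Prop :=
  exists (m : nat) (n : 'I_m -> int) (p : 'I_m -> R -> T),
    [/\ forall k, simplex1 (p k),
        forall q, c q = \sum_k n k * chain_of (p k) q
      & forall x, \sum_k n k * boundary1 (p k) x = 0].

Definition is_boundary (c : (R -> T) -> int) : Prop :=
  exists (m : nat) (n : 'I_m -> int) (s : 'I_m -> R * R -> T),
    (forall k, simplex2 (s k)) /\
    (forall q, c q = \sum_k n k * boundary2 (s k) q).

Definition homologous (c d : (R -> T) -> int) : Prop :=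
  is_boundary (fun q => c q - d q).

End SingularHomology.

Section Curve.
Context {R : realType}.
Local Notation C := (Cplx R).
Variable f : {poly C}.

Definition affine_curve : set (C * C) := [set p | p.2 ^+ 2 = f.[p.1]].

(* For deg f odd there is a single point at infinity, here None. *)
Definition Xcurve := one_point_compactification (affine_curve : Type).

Definition toX (p : C * C) : Xcurve := insub p.

(* Every homology class of Xcurve has such a representative. *)
Definition is_loop (g : R -> C * C) : Prop :=
  [/\ forall t, affine_curve (g t), forall t, g (t + 1) = g t
    & forall t, C1_at (fst \o g) t /\ C1_at (snd \o g) t].

Definition loop_chain (g : R -> C * C) : (R -> Xcurve) -> int :=
  chain_of (toX \o g).

(* On the tangent line of the curve, which is a complex line of C^2, the
   imaginary part of the hermitian product is the area form of the complex
   orientation: it is positive on (v, 'i v). *)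
Definition crossing (g h : R -> C * C) (p : R * R) : R :=
  im ((cderiv (fst \o g) p.1)^* * cderiv (fst \o h) p.2
      + (cderiv (snd \o g) p.1)^* * cderiv (snd \o h) p.2).

Definition transversal_count (g h : R -> C * C) (k : int) : Prop :=
  exists S : seq (R * R),
    [/\ uniq S,
        forall p, p \in S <->
          [/\ 0 <= p.1 < 1, 0 <= p.2 < 1 & g p.1 = h p.2],
        forall p, p \in S -> crossing g h p != 0
      & k = \sum_(p <- S) sgz (crossing g h p)].

Definition intersection (g h : R -> C * C) (k : int) : Prop :=
  exists g' h' : R -> C * C,
    [/\ is_loop g' /\ is_loop h',
        homologous (loop_chain g) (loop_chain g'),
        homologous (loop_chain h) (loop_chain h')
      & transversal_count g' h' k].

Definition symplectic_basis (alpha beta : 'I_3 -> R -> C * C) : Prop :=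
  [/\ forall j, is_loop (alpha j) /\ is_loop (beta j),
      forall c : (R -> Xcurve) -> int, is_cycle c ->
        exists! m : 'cV[int]_3 * 'cV[int]_3,
          homologous c (fun q =>
            \sum_j (m.1 j 0 * loop_chain (alpha j) q
                    + m.2 j 0 * loop_chain (beta j) q)),
      forall i j, intersection (alpha i) (alpha j) 0,
      forall i j, intersection (beta i) (beta j) 0
    & forall i j, intersection (alpha i) (beta j) (i == j : nat)%:Z].

(* The forms are (du_form i x) dx / y and (dr_form i x) dx / y, with i = 1, 2, 3
   and f`_8 = 0. *)
Definition du_form (i : nat) (x : C) : C := x ^+ (3 - i).

Definition dr_form (i : nat) (x : C) : C :=
  \sum_(4 - i <= k < (3 + i).+1) (k + i - 3)%:R * f`_(k + 5 - i) * x ^+ k / 4.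

(* At a branch point x'(t) / y(t) is set to 0; for a C^1 path this differs from
   the pulled back form on a negligible set of parameters only. *)
Definition path_integral (a b : R) (w : C -> C) (g : R -> C * C) : C :=
  cintegral a b
    (fun t => w (g t).1 * cderiv (fst \o g) t / (g t).2).

Section Periods.
Variables alpha beta : 'I_3 -> R -> C * C.

Definition omega1 : 'M[C]_3 :=
  \matrix_(i, j) (path_integral 0 1 (du_form i.+1) (alpha j) / 2).
Definition omega2 : 'M[C]_3 :=
  \matrix_(i, j) (path_integral 0 1 (du_form i.+1) (beta j) / 2).
Definition eta1 : 'M[C]_3 :=
  \matrix_(i, j) (- path_integral 0 1 (dr_form i.+1) (alpha j) / 2).
Definition eta2 : 'M[C]_3 :=
  \matrix_(i, j) (- path_integral 0 1 (dr_form i.+1) (beta j) / 2).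
Definition tau : 'M[C]_3 := invmx omega1 *m omega2.

Definition is_period (l : 'cV[C]_3) : Prop :=
  exists m1 m2 : 'cV[int]_3,
    l = 2 *: (omega1 *m intvec m1) + 2 *: (omega2 *m intvec m2).

(* The values of the integral of (du_1, du_2, du_3) from infinity to Q, along
   C^1 paths ]0, 1] -> affine_curve tending to infinity at 0. *)
Definition abel_value (Q : Xcurve) (v : 'cV[C]_3) : Prop :=
  if Q is Some q then
    exists g : R -> C * C,
      [/\ forall t, 0 < t ->
            [/\ affine_curve (g t), C1_at (fst \o g) t & C1_at (snd \o g) t],
          toX (g t) @[t --> 0^'+] --> (None : Xcurve),
          g 1 = set_val q
        & forall i : 'I_3,
            path_integral e 1 (du_form i.+1) g @[e --> 0^'+] --> v i 0]
  else v = 0.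

Definition theta_partial (z : 'cV[C]_3) (N : nat) : C :=
  \sum_(k : {ffun 'I_3 -> 'I_(N.*2.+1)})
    let n := intvec (\col_i ((k i)%:Z - N%:Z)) in
    cexp (mkC 0 pi * (n^T *m tau *m n) 0 0 + mkC 0 (2 * pi) * (n^T *m z) 0 0).

Definition theta (z : 'cV[C]_3) : C := limn (theta_partial z).

(* Delta is the Riemann constant with base point infinity: the zero set of theta
   is Delta - W_2, where W_2 is the image of pairs of points under the normalized
   Abel map based at infinity. This determines Delta modulo Z^3 + tau Z^3. *)
Definition riemann_constant (Delta : 'cV[C]_3) : Prop :=
  forall z : 'cV[C]_3, theta z = 0 <->
    exists (Q1 Q2 : Xcurve) (v1 v2 : 'cV[C]_3) (m1 m2 : 'cV[int]_3),
      [/\ abel_value Q1 v1, abel_value Q2 v2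
        & z = Delta - invmx (2 *: omega1) *m (v1 + v2)
              + intvec m1 + tau *m intvec m2].

(* d' and d'' stand for 2 delta' and 2 delta''. *)
Definition sigma_quasi_periodic (d' d'' : 'cV[int]_3) (sigma : 'cV[C]_3 -> C) :
    Prop :=
  forall (m1 m2 : 'cV[int]_3) (u : 'cV[C]_3),
    sigma (u + 2 *: (omega1 *m intvec m1) + 2 *: (omega2 *m intvec m2))
    = (-1) ^ ((m1^T *m m2) 0 0 + ((d'^T *m m1) 0 0 - (d''^T *m m2) 0 0))
      * cexp (((2 *: (eta1 *m intvec m1) + 2 *: (eta2 *m intvec m2))^T
               *m (u + omega1 *m intvec m1 + omega2 *m intvec m2)) 0 0)
      * sigma u.

End Periods.

Definition u_1 (u : 'cV[C]_3) : C := u (@Ordinal 3 0 isT) 0.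
Definition u_2 (u : 'cV[C]_3) : C := u (@Ordinal 3 1 isT) 0.
Definition u_3 (u : 'cV[C]_3) : C := u (@Ordinal 3 2 isT) 0.

(* Weights are taken positive: u_1, u_2, u_3 have weights 1, 3, 5. *)
Definition weighted_homogeneous (d : nat) (c : nat -> nat -> nat -> C)
    (u : 'cV[C]_3) : C :=
  \sum_(i < d.+1) \sum_(j < d.+1) \sum_(k < d.+1 | (i + 3 * j + 5 * k == d)%N)
    c i j k * u_1 u ^+ i * u_2 u ^+ j * u_3 u ^+ k.

Definition sigma_expansion (sigma : 'cV[C]_3 -> C) : Prop :=
  exists c : nat -> nat -> nat -> C, \forall u \near (0 : 'cV[C]_3),
    (fun N => u_1 u * u_3 u - u_2 u ^+ 2 - 3^-1 * u_1 u ^+ 3 * u_2 u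
              + 45^-1 * u_1 u ^+ 6
              + \sum_(7 <= d < N) weighted_homogeneous d c u) @ \oo
    --> sigma u.

Definition is_sigma (alpha beta : 'I_3 -> R -> C * C) (d' d'' : 'cV[int]_3)
    (sigma : 'cV[C]_3 -> C) : Prop :=
  [/\ holomorphic sigma, sigma_quasi_periodic alpha beta d' d'' sigma
    & sigma_expansion sigma].

End Curve.

(* Functions on J(X) are functions on C^3 with period set L; Theta is the zero
   divisor of sigma. Values of meromorphic functions on Theta are irrelevant. *)
Section PoleFiltration.
Context {R : realType}.
Local Notation C := (Cplx R).
Local Notation fn := ('cV[C]_3 -> C).
Variables (L : 'cV[C]_3 -> Prop) (sigma : fn).

(* A(n) *)
Definition pole_le (n : nat) (a : fn) : Prop :=
  (forall l u, L l -> sigma u != 0 -> a (u + l) = a u) /\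
  (exists2 F : fn, holomorphic F &
    forall u, sigma u != 0 -> a u = F u / sigma u ^+ n).

(* A(n - 1), with A(-1) = 0 *)
Definition pole_lt (n : nat) (a : fn) : Prop :=
  if n is k.+1 then pole_le k a else forall u, sigma u != 0 -> a u = 0.

(* gr^P A, each element being given by representatives g n \in A(n) of its
   homogeneous components, almost all of which vanish in A(n) / A(n - 1). *)
Definition in_gr (g : nat -> fn) : Prop :=
  (forall n, pole_le n (g n)) /\
  (exists N, forall n, (N <= n)%N -> pole_lt n (g n)).

Definition gr_eq (g h : nat -> fn) : Prop :=
  forall n, pole_lt n (fun u => g n u - h n u).

Definition gr_partial (i : 'I_3) (g : nat -> fn) : nat -> fn :=
  fun n => if n is k.+1 then partial i (g k) else fun=> 0.

(* A submodule over C[d_1, d_2, d_3], i.e. a subspace stable under each d_i. *)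
Definition gr_submodule (M : (nat -> fn) -> Prop) : Prop :=
  [/\ forall g, M g -> in_gr g,
      forall g h, M g -> in_gr h -> gr_eq g h -> M h,
      M (fun _ _ => 0),
      forall (c : C) g h, M g -> M h -> M (fun n u => c * g n u + h n u)
    & forall i g h, M g -> in_gr h -> gr_eq (gr_partial i g) h -> M h].

Definition gr_finitely_generated : Prop :=
  exists (m : nat) (e : 'I_m -> nat -> fn),
    (forall k, in_gr (e k)) /\
    (forall M, gr_submodule M -> (forall k, M (e k)) ->
       forall g, in_gr g -> M g).

End PoleFiltration.

(* Main.v *)
Require Import Defs.
From mathcomp Require Import all_boot all_order all_algebra.
From mathcomp Require Import complex.
From mathcomp Require Import all_classical all_reals all_analysis.
From mathcomp Require Import ring.
Import Order.TTheory GRing.Theory Num.Theory.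
Import numFieldNormedType.Exports.
Local Open Scope ring_scope.

(** The theta divisor of a hyperelliptic curve of genus 3 is singular, and the
    singular point is the obstruction. The expansion of sigma at 0 has no linear
    term, since u_1, u_2, u_3 have weights 1, 3, 5 and the leading part, of
    weight 6, is in the square of the maximal ideal; hence sigma and its three
    first derivatives vanish at 0.

    Write an element of A(n) as F / sigma^n and call F its leading coefficient;
    modulo A(n-1), the germ of F at 0 is determined up to a multiple of sigma.
    A derivation maps F / sigma^n to
    (sigma dF - n F dsigma) / sigma^(n+1), whose leading coefficient vanishes at
    0 whatever F is. So the elements of the graded module whose leading
    coefficients vanish at 0 in all degrees above N form a submodule
    (gr_leading_vanishes_submodule). It contains any finite set of generators
    as soon as N bounds their degrees, and would then be everything.

    On the other hand A(2) contains
    sigma (u + a) sigma (u - a) / sigma (u)^2, because the factors of automorphy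
    cancel (translate_ratio_pole_le). At u = 0 its leading coefficient is
    sigma (a) sigma (- a), which is nonzero for a suitable small a on the first
    coordinate axis, where sigma behaves like u_1^6 / 45 (sigma_axis_neq0). Its
    powers have pole orders beyond any N, a contradiction. *)

(** * Tails of power series *)

Section PowerSeries.
Set Implicit Arguments.
Local Open Scope classical_set_scope.
Context {K : numFieldType}.

Lemma exprn_cvg n (a : K) : s ^+ n @[s --> a] --> a ^+ n.
Proof.
elim: n => [|n /(continuousM cvg_id) IHn]; first exact: cst_continuous.
by rewrite exprS; under eq_fun do rewrite exprS; exact: IHn.
Qed.

Lemma exprn_cvg_dnbhs n : (0 < n)%N -> s ^+ n @[s --> (0 : K)^'] --> (0 : K)^'.
Proof.
move=> n0 A A0; have := @exprn_cvg n 0.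
rewrite expr0n gtn_eqF //= => /(_ _ A0) nA.
change (nbhs (0 : K) [set s : K | s != 0 -> A (s ^+ n)]).
apply: (filterS _ (nA : nbhs (0 : K) _)) => s /= As sn0.
by apply: As; rewrite expf_neq0.
Qed.

Lemma cvg_norm_le (x : nat -> K) (l b : K) :
  (forall N, `|x N| <= b) -> x @ \oo --> l -> `|l| <= b.
Proof.
move=> xb xl; rewrite real_leNgt ?normr_real //; last first.
  exact/ger0_real/(le_trans (normr_ge0 _))/(xb 0%N).
apply/negP => bl; have e0 : 0 < `|l| - b by rewrite subr_gt0.
have [N _ /(_ N (leqnn N)) /= lN] : \forall N \near \oo, `|l - x N| < `|l| - b.
  exact: cvgr_dist_lt xl _ e0.
have : `|l| < `|l|.
  apply: le_lt_trans (_ : `|l - x N| + `|x N| < _).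
    by rewrite -{1}(subrK (x N) l) ler_normD.
  by rewrite -ltrBrDr; apply: lt_le_trans lN _; rewrite lerB.
by rewrite ltxx.
Qed.

Lemma geometric_tail_le (q : K) (m n : nat) :
  0 <= q -> q *+ 2 <= 1 ->
  \sum_(m <= d < m + n) q ^+ d <= 2 * q ^+ m.
Proof.
move=> q0 q2.
(* The slack term makes the induction go through: q^k + 2 q^(k+1) <= 2 q^k. *)
suff : \sum_(m <= d < m + n) q ^+ d + 2 * q ^+ (m + n) <= 2 * q ^+ m.
  by apply: le_trans; rewrite lerDl mulr_ge0 ?exprn_ge0.
elim: n => [|n IHn]; first by rewrite addn0 big_geq // add0r.
rewrite addnS big_nat_recr ?leq_addr //=; apply: le_trans IHn.
rewrite -addrA lerD2l exprS mulrA mulr_natl.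
by rewrite [leRHS]mulr_natl mulr2n lerD2l ler_piMl ?exprn_ge0.
Qed.

(** Convergence at the single point s0 bounds the terms at s0, and a geometric
    series of ratio at most 1/2 dominates the tail on the disc of half the radius. *)
Lemma power_series_tail_bound (m : nat) (c : nat -> K) (g : K -> K) (s0 : K) :
  s0 != 0 ->
  (forall s, `|s| <= `|s0| ->
     (fun N => \sum_(m <= d < N) s ^+ d * c d) @ \oo --> g s) ->
  exists2 B, 0 <= B & forall s, `|s| <= `|s0| / 2 -> `|g s| <= B * `|s| ^+ m.
Proof.
move=> s0n0 cvg_g; have s0_gt0 : 0 < `|s0| by rewrite normr_gt0.
have [B0 B0_ge0 B0P] : exists2 B0, 0 <= B0 &
    forall d, (m <= d)%N -> `|s0 ^+ d * c d| <= B0.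
  (* Each term is a difference of two partial sums, which are bounded. *)
  have /cvgP/cvg_seq_bounded/pinfty_ex_gt0[B1 B1_gt0 B1P] := cvg_g s0 (lexx _).
  have B1P' N : `|\sum_(m <= d < N) s0 ^+ d * c d| <= B1 by apply: B1P.
  exists (B1 + B1); first by rewrite ltW ?addr_gt0.
  move=> d md; have -> : s0 ^+ d * c d = \sum_(m <= d < d.+1) s0 ^+ d * c d
      - \sum_(m <= d < d) s0 ^+ d * c d.
    by rewrite big_nat_recr //= [X in X - _]addrC addrK.
  by apply: le_trans (ler_normB _ _) _; apply: lerD.
exists (2 * B0 / `|s0| ^+ m); first by rewrite divr_ge0 ?mulr_ge0 ?exprn_ge0.
move=> s s_le.
have s_le0 : `|s| <= `|s0|.
  by apply: le_trans s_le _; rewrite ler_pdivrMr // ler_peMr ?ler1n ?ltW.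
have sE : 2 * B0 / `|s0| ^+ m * `|s| ^+ m = B0 * (2 * (`|s| / `|s0|) ^+ m).
  by rewrite expr_div_n; ring.
rewrite sE; apply: cvg_norm_le (cvg_g s s_le0) => N.
apply: le_trans (ler_norm_sum _ _ _) _.
have q0 : 0 <= `|s| / `|s0| by rewrite divr_ge0.
have : \sum_(m <= d < N) `|s ^+ d * c d|
    <= \sum_(m <= d < N) B0 * (`|s| / `|s0|) ^+ d.
  apply: ler_sum_nat => d /andP[md _].
  have -> : s ^+ d * c d = (s / s0) ^+ d * (s0 ^+ d * c d).
    by rewrite mulrA -exprMn divfK.
  by rewrite normrM normrX normf_div mulrC ler_wpM2r ?exprn_ge0 ?B0P.
move=> /le_trans; apply; rewrite -mulr_sumr ler_wpM2l //.
have [Nm|mN] := leqP N m; first by rewrite big_geq // mulr_ge0 ?exprn_ge0.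
rewrite -(subnKC (ltnW mN)) geometric_tail_le //.
by rewrite -mulrnAl ler_pdivrMr // mul1r -mulr_natr -ler_pdivlMr.
Qed.

End PowerSeries.

(** * The expansion of sigma at the origin *)

Section SigmaAtOrigin.
Set Implicit Arguments.
Local Open Scope classical_set_scope.
Context {R : realType}.
Local Notation C := (Cplx R).
Local Notation V := 'cV[C]_3.

(** The action of the multiplicative group for which u_1, u_2, u_3 have weights
    1, 3, 5: along its orbits the expansion of sigma by weight becomes a power
    series in one variable. *)
Definition wscale (s : C) (p : V) : V :=
  \sum_(i < 3) (s ^+ i.*2.+1 * p i 0) *: delta_mx i 0.

Lemma wscaleE s p i : wscale s p i 0 = s ^+ i.*2.+1 * p i 0.
Proof.
rewrite /wscale summxE (bigD1 i) //= big1 ?addr0 => [|j ji].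
  by rewrite !mxE !eqxx mulr1.
by rewrite !mxE eq_sym (negPf ji) mulr0.
Qed.

Lemma wscale_delta s i : wscale s (delta_mx i 0) = s ^+ i.*2.+1 *: delta_mx i 0.
Proof.
apply/colP => j; rewrite wscaleE !mxE.
by case: eqP => [->|_]; rewrite ?mulr0.
Qed.

Lemma wscale0 p : wscale 0 p = 0.
Proof. by apply/colP => j; rewrite wscaleE mxE expr0n mul0r. Qed.

Lemma wscale_cvg0 p : wscale s p @[s --> (0 : C)] --> (0 : V).
Proof.
rewrite -[X in _ --> X](wscale0 p).
apply: (@cvg_big V _ +%R 0 _ _ _ (nbhs (0 : C))) => [|i _].
  exact: add_continuous.
by apply: cvgZr_tmp; apply: cvgMr_tmp; exact: exprn_cvg.
Qed.

Lemma weighted_homogeneous_wscale d c s p :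
  weighted_homogeneous d c (wscale s p) = s ^+ d * weighted_homogeneous d c p.
Proof.
rewrite /weighted_homogeneous mulr_sumr; apply: eq_bigr => i _.
rewrite mulr_sumr; apply: eq_bigr => j _.
rewrite mulr_sumr; apply: eq_bigr => k /eqP ijk.
have -> : s ^+ d = s ^+ i * (s ^+ 3) ^+ j * (s ^+ 5) ^+ k.
  by rewrite -!exprM -!exprD ijk.
by rewrite /u_1 /u_2 /u_3 !wscaleE /= !exprMn; ring.
Qed.

Definition sigma_leading (u : V) : C :=
  u_1 u * u_3 u - u_2 u ^+ 2 - 3^-1 * u_1 u ^+ 3 * u_2 u + 45^-1 * u_1 u ^+ 6.

Lemma sigma_leading_wscale s p :
  sigma_leading (wscale s p) = s ^+ 6 * sigma_leading p.
Proof. by rewrite /sigma_leading /u_1 /u_2 /u_3 !wscaleE /=; ring. Qed.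

Variable sigma : V -> C.
Hypothesis sigma_exp : sigma_expansion sigma.

(** On the orbit of p the terms of weight at least 7 form the tail of a power
    series in s, so they are O(s^7). *)
Lemma sigma_wscale_bound p : exists2 B, 0 <= B &
  \forall s \near (0 : C),
    `|sigma (wscale s p) - s ^+ 6 * sigma_leading p| <= B * `|s| ^+ 7.
Proof.
case: sigma_exp => c c_cvg.
have [r /= r0 rP] := wscale_cvg0 p c_cvg.
have r20 : `|r / 2| = r / 2 by rewrite ger0_norm // divr_ge0 // ltW.
have r2_gt0 : 0 < r / 2 by rewrite divr_gt0.
have [||B B0 BP] := @power_series_tail_bound _ 7
  (fun d => weighted_homogeneous d c p)
  (fun s => sigma (wscale s p) - s ^+ 6 * sigma_leading p) (r / 2).
- by rewrite gt_eqF.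
- move=> s s_le; have /rP /= cvgs : ball_ Num.norm 0 r s.
    rewrite /= sub0r normrN; apply: le_lt_trans s_le _.
    by rewrite r20 ltr_pdivrMr // ltr_pMr // ltr1n.
  rewrite -sigma_leading_wscale.
  under eq_fun => N.
    have -> : \sum_(7 <= d < N) s ^+ d * weighted_homogeneous d c p =
        sigma_leading (wscale s p)
        + \sum_(7 <= d < N) weighted_homogeneous d c (wscale s p)
        - sigma_leading (wscale s p).
      rewrite addrAC subrr add0r.
      by apply: eq_bigr => d _; rewrite weighted_homogeneous_wscale.
    over.
  exact: (cvgB (V := C) cvgs (cvg_cst _)).
exists B => //; exists (r / 2 / 2) => /=; first by rewrite divr_gt0.
by move=> s; rewrite /= sub0r normrN => /ltW s_le; apply: BP; rewrite r20.
Qed.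

Lemma sigma0 : sigma 0 = 0.
Proof.
have [B _ /nbhs_singleton] := sigma_wscale_bound 0.
rewrite wscale0 !expr0n /= mul0r subr0 normr0 expr0n mulr0 normr_le0.
by move/eqP.
Qed.

(** The orbit of the i-th basis vector runs along the i-th axis as s^w with
    w = 1, 3 or 5, while sigma is O(s^6) on it; the difference quotient is thus
    O(s). *)
Lemma partial_sigma0 i : differentiable sigma 0 -> partial i sigma 0 = 0.
Proof.
move=> dsigma; have w6 : (i.*2.+1 < 6)%N by case: i => [[|[|[|]]]].
set w := i.*2.+1 in w6.
have [B B0 BP] := sigma_wscale_bound (delta_mx i 0).
set L := sigma_leading (delta_mx i 0) in BP.
have /cvg_ex[/= D Dcvg] := diff_derivable (v := delta_mx i 0 : V) dsigma.
have -> : partial i sigma 0 = D by apply: (cvg_lim (@norm_hausdorff _ C)).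
(* The difference quotient is taken at the step s^w. *)
have {}Dcvg := cvg_comp _ _ (@exprn_cvg_dnbhs C w isT) Dcvg.
rewrite -(cvg_lim (@norm_hausdorff _ C) Dcvg).
apply: (cvg_lim (@norm_hausdorff _ C)).
apply/(cvgr0Pnorm_lt (V := C)) => e e0.
have M0 : 0 < `|L| + B + 1 by rewrite ltr_wpDl ?addr_ge0.
near=> s.
have sn0 : s != 0 by near: s; exact: nbhs_dnbhs_neq.
have s1 : `|s| <= 1 by near: s; apply: dnbhs0_le.
have : `|sigma (wscale s (delta_mx i 0)) - s ^+ 6 * L| <= B * `|s| ^+ 7.
  by near: s; apply: nbhs_dnbhs.
have : `|s| < e / (`|L| + B + 1) by near: s; apply: dnbhs0_lt; rewrite divr_gt0.
rewrite wscale_delta -/w /= addr0 sigma0 subr0 ltr_pdivlMr // => se sB.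
apply: le_lt_trans _ se; rewrite normrZ normfV normrX.
have s_gt0 : 0 < `|s| by rewrite normr_gt0.
rewrite mulrC ler_pdivrMr ?exprn_gt0 // -[X in `|X|](subrK (s ^+ 6 * L)).
apply: le_trans (ler_normD _ _) _; apply: le_trans (lerD sB (lexx _)) _.
have s6 : `|s| ^+ 6 <= `|s| * `|s| ^+ w.
  by rewrite -exprS ler_wiXn2l.
rewrite normrM normrX exprS.
have -> : B * (`|s| * `|s| ^+ 6) + `|s| ^+ 6 * `|L| =
   `|s| ^+ 6 * (B * `|s| + `|L|) by ring.
rewrite [leRHS]mulrAC; apply: ler_pM => //; first by rewrite addr_ge0 ?mulr_ge0.
by rewrite addrC -addrA lerD2l ler_wpDr // ler_piMr.
Unshelve. all: by end_near. Qed.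

(** On the first axis sigma is s^6 / 45 + O(s^7). *)
Lemma sigma_axis_neq0 : \forall s \near (0 : C)^',
  sigma (s *: delta_mx ord0 0) != 0.
Proof.
have [B B0 BP] := sigma_wscale_bound (delta_mx ord0 0).
have M0 : 0 < 45 * B + 1 by rewrite ltr_wpDl ?mulr_ge0.
near=> s.
have sn0 : s != 0 by near: s; exact: nbhs_dnbhs_neq.
have s_gt0 : 0 < `|s| by rewrite normr_gt0.
have : `|s| < (45 * B + 1)^-1 by near: s; apply: dnbhs0_lt; rewrite invr_gt0.
have : `|sigma (wscale s (delta_mx ord0 0))
     - s ^+ 6 * sigma_leading (delta_mx ord0 0)| <= B * `|s| ^+ 7.
  by near: s; apply: nbhs_dnbhs.
rewrite wscale_delta expr1 /sigma_leading /u_1 /u_2 /u_3 !mxE /=.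
rewrite !mulr0 expr0n /= !subr0 expr1n add0r mulr1.
move=> sB sM; apply/eqP => s0; move: sB.
rewrite s0 sub0r normrN normrM normfV normr_nat normrX (exprSr _ 6) mulrCA.
rewrite ler_pM2l ?exprn_gt0 // -[_^-1]mul1r ler_pdivrMr // => sB.
move: sM; rewrite -[_^-1]mul1r ltr_pdivlMr // => /(le_lt_trans _) sM.
suff /sM : 1 <= `|s| * (45 * B + 1) by rewrite ltxx.
apply: le_trans sB _.
have -> : B * `|s| * 45 = `|s| * (45 * B) by ring.
by rewrite ler_wpM2l // lerDl.
Unshelve. all: by end_near. Qed.

Lemma sigma_neq0_near0 (A : set V) :
  nbhs (0 : V) A -> exists2 u, A u & sigma u != 0.
Proof.
move=> A0; have : \forall s \near (0 : C)^', A (s *: delta_mx ord0 0).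
  apply: nbhs_dnbhs; have /= As := wscale_cvg0 (delta_mx ord0 0) A0.
  apply: (filterS _ (As : nbhs (0 : C) _)) => s /=.
  by rewrite wscale_delta expr1.
move=> /(filterI sigma_axis_neq0)/filter_ex[s [s0 As]].
by exists (s *: delta_mx ord0 0).
Qed.

Lemma sigma_neq0_opp : exists2 a : V, sigma a != 0 & sigma (- a) != 0.
Proof.
have [r /= r0 rP] := sigma_axis_neq0.
have axis_neq0 (s : C) :
    s != 0 -> `|s| < r -> sigma (s *: delta_mx ord0 0) != 0.
  by move=> s0 sr; apply: rP; rewrite //= sub0r normrN.
have r2_neq0 : r / 2 != 0 by rewrite mulf_neq0 ?gt_eqF.
have r2_lt : `|r / 2| < r.
  by rewrite ger0_norm ?divr_ge0 ?ltW // ltr_pdivrMr // ltr_pMr // ltr1n.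
exists ((r / 2) *: delta_mx ord0 0); first exact: axis_neq0.
by rewrite -scaleNr; apply: axis_neq0; rewrite ?oppr_eq0 ?normrN.
Qed.

End SigmaAtOrigin.

(** * Holomorphic functions and quotients by powers *)

Section PoleOrder.
Set Implicit Arguments.
Local Open Scope classical_set_scope.
Context {R : realType}.
Local Notation C := (Cplx R).
Local Notation V := 'cV[C]_3.

Lemma holomorphic_continuous (F : V -> C) : holomorphic F -> continuous F.
Proof. by case=> dF _ u; exact/differentiable_continuous. Qed.

Lemma holomorphic_derivable (F : V -> C) u v : holomorphic F -> derivable F u v.
Proof. by case=> dF _; exact: diff_derivable. Qed.

Lemma holomorphic_cst (c : C) : holomorphic (fun=> c : C).
Proof.
split=> [u|i]; first exact: differentiable_cst.
have -> : partial i (fun=> c) = (fun=> 0).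
  by apply/funext => u; exact: derive_cst.
exact: cst_continuous.
Qed.

Lemma holomorphicD (F G : V -> C) :
  holomorphic F -> holomorphic G -> holomorphic (fun u => F u + G u).
Proof.
move=> hF hG; split=> [u|i].
  by apply: differentiableD; [apply: hF.1 | apply: hG.1].
have -> : partial i (fun u => F u + G u) =
    fun u => partial i F u + partial i G u.
  by apply/funext => u; apply: deriveD; exact: holomorphic_derivable.
by move=> u; exact: (cvgD (V := C) (hF.2 i u) (hG.2 i u)).
Qed.

Lemma holomorphicM (F G : V -> C) :
  holomorphic F -> holomorphic G -> holomorphic (fun u => F u * G u).
Proof.
move=> hF hG; split=> [u|i].
  by apply: differentiableM; [apply: hF.1 | apply: hG.1].
have -> : partial i (fun u => F u * G u) =
    fun u => F u * partial i G u + G u * partial i F u.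
  by apply/funext => u; apply: deriveM; exact: holomorphic_derivable.
move=> u; have Fc := holomorphic_continuous hF u.
have Gc := holomorphic_continuous hG u.
exact: (cvgD (V := C) (cvgM Fc (hG.2 i u)) (cvgM Gc (hF.2 i u))).
Qed.

Lemma holomorphicX (F : V -> C) n :
  holomorphic F -> holomorphic (fun u => F u ^+ n).
Proof.
move=> hF; elim: n => [|n IHn]; first exact: holomorphic_cst.
by under eq_fun do rewrite exprS; exact: holomorphicM.
Qed.

Lemma holomorphic_shift (F : V -> C) a :
  holomorphic F -> holomorphic (fun u => F (u + a)).
Proof.
move=> hF.
have dshift (u : V) : differentiable (fun v : V => v + a) u.
  by apply: differentiableD => //; exact: differentiable_cst.
split=> [u|i]; first exact: (differentiable_comp (dshift u) (hF.1 _)).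
have -> : partial i (fun u => F (u + a)) = fun u => partial i F (u + a).
  apply/funext => u; rewrite /partial /derive.
  by under eq_fun do rewrite /= -addrA.
move=> u; apply: (@continuous_comp _ _ _ (fun u : V => u + a) (partial i F)).
  exact: differentiable_continuous (dshift u).
exact: hF.2.
Qed.

Lemma derive_quotientX (K : numFieldType) (W : normedModType K) (F s : W -> K)
    (a : W -> K) n u v :
  derivable F u v -> derivable s u v -> s u != 0 ->
  (\forall w \near u, a w = F w / s w ^+ n) ->
  'D_v a u = (s u * 'D_v F u - n%:R * F u * 'D_v s u) / s u ^+ n.+1.
Proof.
move=> dF ds su0 aE.
have -> : 'D_v a u = 'D_v (F * (fun w => ((s ^+ n) w)^-1)) u.
  by apply: near_eq_derive; apply: filterS aE => w ->; rewrite exprfctE.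
have sn0 : (s ^+ n) u != 0 by rewrite exprfctE expf_neq0.
have dsn : derivable (s ^+ n) u v by exact: derivableX.
rewrite (deriveM dF (derivableV sn0 dsn)) (deriveV sn0 dsn) (deriveX n ds).
rewrite exprfctE /GRing.scale /=; case: n {aE sn0 dsn} => [|n].
  rewrite mulr0n !mul0r !mulr0 add0r subr0 expr0 invr1 mul1r expr1.
  by rewrite mulrC mulKf.
by rewrite !exprS /=; field; rewrite su0 expf_neq0.
Qed.

(** Agreement off the zeros of s is enough, since s has no zero in a
    neighbourhood of u. *)
Lemma partial_quotient (F s : V -> C) (a : V -> C) n i u :
  holomorphic F -> holomorphic s -> s u != 0 ->
  (forall v, s v != 0 -> a v = F v / s v ^+ n) ->
  partial i a u =
    (s u * partial i F u - n%:R * F u * partial i s u) / s u ^+ n.+1.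
Proof.
move=> hF hs su0 aE.
have s_near : \forall v \near u, s v != 0.
  exact: (@cvgr_neq0 _ C V (nbhs u) _ s _ (holomorphic_continuous hs u) su0).
apply: derive_quotientX => //; try exact: holomorphic_derivable.
by apply: filterS s_near => v; exact: aE.
Qed.

End PoleOrder.

(** * Factors of automorphy *)

Section Automorphy.
Set Implicit Arguments.
Context {R : realType}.
Local Notation C := (Cplx R).
Local Notation V := 'cV[C]_3.

Lemma cexpD (x y : C) : cexp (x + y) = cexp x * cexp y.
Proof.
case: x y => [a b] [c d]; rewrite /cexp /mkC /re /im /=.
apply/eqP; rewrite eq_complex /= expRD cosD sinD.
by apply/andP; split; apply/eqP; ring.
Qed.

Lemma cexp_neq0 (x : C) : cexp x != 0.
Proof.
apply/eqP => x0; have : cexp (x - x) = 0 by rewrite cexpD x0 mul0r.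
rewrite subrr /cexp /mkC /re /im /= expR0 cos0 sin0 mulr0 mulr1.
by move/eqP; rewrite eq_complex /= oner_eq0.
Qed.

(** The second condition holds for the exponential of an affine function; it is
    what makes the factors of sigma (u + a) sigma (u - a) and of sigma (u)^2
    equal. *)
Definition automorphic (sigma : V -> C) (l : V) : Prop :=
  exists e : V -> C,
    [/\ forall u, e u != 0, forall u a, e (u + a) * e (u - a) = e u ^+ 2
      & forall u, sigma (u + l) = e u * sigma u].

Lemma sigma_automorphic (alpha beta : 'I_3 -> R -> C * C) d' d'' f sigma l :
  sigma_quasi_periodic f alpha beta d' d'' sigma ->
  is_period alpha beta l -> automorphic sigma l.
Proof.
move=> sigma_qp [m1 [m2 ->]].
pose chi : C :=
  (-1) ^ ((m1^T *m m2) 0 0 + ((d'^T *m m1) 0 0 - (d''^T *m m2) 0 0)).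
pose W : V :=
  2 *: (eta1 f alpha *m intvec m1) + 2 *: (eta2 f beta *m intvec m2).
pose h : V := omega1 alpha *m intvec m1 + omega2 beta *m intvec m2.
exists (fun u => chi * cexp ((W^T *m (u + h)) 0 0)); split => [u|u a|u].
- by rewrite mulf_neq0 ?cexp_neq0 // expfz_neq0 // oppr_eq0 oner_eq0.
- have sqrM (c x y z : C) : x * y = z * z -> c * x * (c * y) = (c * z) ^+ 2.
    by move=> xy; rewrite mulrACA xy expr2 mulrACA.
  apply: sqrM; rewrite -!cexpD.
  have addmxE (A B : 'M[C]_1) : A 0 0 + B 0 0 = (A + B) 0 0 by rewrite mxE.
  suff WE : W^T *m (u + a + h) + W^T *m (u - a + h) =
      W^T *m (u + h) + W^T *m (u + h) by rewrite addmxE WE -addmxE.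
  rewrite -!mulmxDr; congr (_ *m _).
  by rewrite addrACA [u + a + _]addrACA subrr addr0 addrACA.
- by rewrite (addrA u (omega1 _ *m _)) (addrA u (2 *: _)); exact: sigma_qp.
Qed.

End Automorphy.

(** * The graded module *)

Section GradedModule.
Set Implicit Arguments.
Local Open Scope classical_set_scope.
Context {R : realType}.
Local Notation C := (Cplx R).
Local Notation V := 'cV[C]_3.
Variables (L : V -> Prop) (sigma : V -> C).
Hypothesis holo_sigma : holomorphic sigma.

Lemma pole_le0 n : pole_le L sigma n (fun=> 0).
Proof.
split=> //; exists (fun=> 0); first exact: holomorphic_cst.
by move=> u _; rewrite mul0r.
Qed.

Lemma pole_le_linear n c a b : pole_le L sigma n a -> pole_le L sigma n b ->
  pole_le L sigma n (fun u => c * a u + b u).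
Proof.
move=> [aL [F hF aF]] [bL [G hG bG]]; split=> [l u Ll u0|].
  by rewrite aL // bL.
exists (fun u => c * F u + G u) => [|u u0].
  exact: holomorphicD (holomorphicM (holomorphic_cst c) hF) hG.
by rewrite aF // bG // mulrDl mulrA.
Qed.

Lemma pole_lt0 n : pole_lt L sigma n (fun=> 0).
Proof. by case: n => //= n; exact: pole_le0. Qed.

Lemma pole_lt_linear n c a b : pole_lt L sigma n a -> pole_lt L sigma n b ->
  pole_lt L sigma n (fun u => c * a u + b u).
Proof.
case: n => [|n] /= Pa Pb; last exact: pole_le_linear.
by move=> u u0; rewrite Pa // Pb // mulr0 addr0.
Qed.

Lemma in_gr_linear c g h : in_gr L sigma g -> in_gr L sigma h ->
  in_gr L sigma (fun n u => c * g n u + h n u).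
Proof.
move=> [gP [N gN]] [hP [M hM]]; split=> [n|]; first exact: pole_le_linear.
exists (maxn N M) => n; rewrite geq_max => /andP[Nn Mn].
by apply: pole_lt_linear; [exact: gN | exact: hM].
Qed.

(** Only a limit at 0 is asked of F, so that the condition is preserved by
    derivations without any appeal to the holomorphy of partial derivatives. *)
Definition leading_coef_vanishes (n : nat) (a : V -> C) : Prop :=
  exists2 F : V -> C, F @ (0 : V) --> (0 : C) &
    forall u, sigma u != 0 -> a u = F u / sigma u ^+ n.

Lemma leading_coef_vanishes_linear n c a b :
  leading_coef_vanishes n a -> leading_coef_vanishes n b ->
  leading_coef_vanishes n (fun u => c * a u + b u).
Proof.
move=> [F F0 aF] [G G0 bG]; exists (fun u => c * F u + G u) => [|u u0].
  rewrite -[X in _ --> X](addr0 (0 : C)) -{1}(mulr0 c).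
  exact: (cvgD (V := C) (cvgMl_tmp F0) G0).
by rewrite aF // bG // mulrDl mulrA.
Qed.

Hypothesis sigma0 : sigma 0 = 0.

(** Raising the exponent of the denominator multiplies the numerator by sigma,
    which vanishes at 0: the condition depends on the class in A(n) / A(n-1)
    only. *)
Lemma pole_lt_leading_coef_vanishes n a :
  pole_lt L sigma n.+1 a -> leading_coef_vanishes n.+1 a.
Proof.
move=> [_ [F hF aF]]; exists (fun u => F u * sigma u) => [|u u0].
  rewrite -[X in _ --> X](mulr0 (F 0)) -{1}sigma0.
  exact: (cvgM (holomorphic_continuous hF (0 : V))
    (holomorphic_continuous holo_sigma (0 : V))).
by rewrite aF // exprSr invfM mulrACA divff ?mulr1.
Qed.

Hypothesis partial_sigma0 : forall i, partial i sigma 0 = 0.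

(** The singularity of the theta divisor at 0 enters here: both terms of the
    numerator sigma dF - n F dsigma vanish at 0. *)
Lemma partial_leading_coef_vanishes n i a :
  pole_le L sigma n a -> leading_coef_vanishes n.+1 (partial i a).
Proof.
move=> [_ [F hF aF]].
exists (fun u => sigma u * partial i F u - n%:R * F u * partial i sigma u).
  have -> : (0 : C) = sigma 0 * partial i F 0 - n%:R * F 0 * partial i sigma 0.
    by rewrite sigma0 partial_sigma0 mul0r mulr0 subr0.
  have Fc := holomorphic_continuous hF (0 : V).
  have sc := holomorphic_continuous holo_sigma (0 : V).
  exact: (cvgB (V := C) (cvgM sc (hF.2 i 0))
    (cvgM (cvgMl_tmp Fc) (holo_sigma.2 i 0))).
by move=> u u0; exact: partial_quotient.
Qed.

Definition gr_leading_vanishes (N : nat) (g : nat -> V -> C) : Prop :=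
  in_gr L sigma g /\ forall n, (N < n)%N -> leading_coef_vanishes n (g n).

Lemma gr_leading_vanishes_submodule N :
  gr_submodule L sigma (gr_leading_vanishes N).
Proof.
split.
- by move=> g [].
- move=> g h [_ gN] hin gh; split=> // -[|n] Nn //.
  have := leading_coef_vanishes_linear (-1)
    (pole_lt_leading_coef_vanishes (gh n.+1)) (gN _ Nn).
  by case=> F F0 FE; exists F => // u /FE <-; ring.
- split.
    split=> [n|]; first exact: pole_le0.
    by exists 0%N => n _; exact: pole_lt0.
  by case=> [|n] // _; exact: pole_lt_leading_coef_vanishes (pole_lt0 n.+1).
- move=> c g h [gin gN] [hin hN]; split; first exact: in_gr_linear.
  by move=> n Nn; apply: leading_coef_vanishes_linear; [exact: gN | exact: hN].
- move=> i g h [[gP _] gN] hin gh; split=> // -[|n] Nn //.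
  have := leading_coef_vanishes_linear (-1)
    (pole_lt_leading_coef_vanishes (gh n.+1))
    (partial_leading_coef_vanishes i (gP n)).
  by case=> F F0 FE; exists F => // u /FE <- /=; ring.
Qed.

(** Above a common bound N of the degrees of the generators, their components
    are zero classes, whose leading coefficients are multiples of sigma. *)
Lemma gr_finitely_generated_leading_vanishes :
  gr_finitely_generated L sigma ->
  exists N, forall g, in_gr L sigma g -> gr_leading_vanishes N g.
Proof.
move=> [m [e [e_in gen]]].
have [N NP] := fin_all_exists (fun k => (e_in k).2).
exists (\max_k N k)%N => g; apply: gen.
  exact: gr_leading_vanishes_submodule.
move=> k; split=> // -[|n] kn //; apply: pole_lt_leading_coef_vanishes.
by apply: NP; apply: leq_trans (ltnW kn); exact: leq_bigmax.
Qed.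

Hypothesis sigma_automorphy : forall l, L l -> automorphic sigma l.

Definition translate_ratio (a u : V) : C :=
  sigma (u + a) * sigma (u - a) / sigma u ^+ 2.

(** By the theorem of the square the translates of the theta divisor by a and by
    - a add up to a divisor equivalent to twice the theta divisor; the factors
    of automorphy make this explicit. *)
Lemma translate_ratio_pole_le a m :
  pole_le L sigma m.*2 (fun u => translate_ratio a u ^+ m).
Proof.
split=> [l u Ll u0|].
  have [e [e0 eM eE]] := sigma_automorphy Ll.
  congr (_ ^+ m); rewrite /translate_ratio ![u + l + _]addrAC !eE.
  rewrite mulrACA eM exprMn invfM mulrACA divff ?mul1r //.
  by rewrite expf_neq0.
exists (fun u => (sigma (u + a) * sigma (u - a)) ^+ m) => [|u u0].
  exact: holomorphicX
    (holomorphicM (holomorphic_shift _ _) (holomorphic_shift _ _)).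
by rewrite /translate_ratio expr_div_n -exprM mul2n.
Qed.

(** Density of the complement of the zero set of sigma near 0 transfers the
    comparison of two numerators to their limits at 0. *)
Lemma not_gr_finitely_generated a :
  sigma a != 0 -> sigma (- a) != 0 ->
  (forall A, nbhs (0 : V) A -> exists2 u, A u & sigma u != 0) ->
  ~ gr_finitely_generated L sigma.
Proof.
move=> a0 Na0 dense /gr_finitely_generated_leading_vanishes[N van].
pose m := N.+1.
(* The power m of the ratio, placed in degree 2 m > N. *)
pose g n (u : V) := if n == m.*2 then translate_ratio a u ^+ m else 0.
have gin : in_gr L sigma g.
  split=> [n|].
    rewrite /g; case: eqP => [->|_]; last exact: pole_le0.
    exact: translate_ratio_pole_le.
  by exists m.*2.+1 => n mn; rewrite /g gtn_eqF //; exact: pole_lt0.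
have [_ /(_ m.*2)[|F F0 FE]] := van g gin.
  by rewrite /m -addnn addSn ltnS leq_addr.
pose H (u : V) := (sigma (u + a) * sigma (u - a)) ^+ m.
have hH : holomorphic H.
  exact: holomorphicX
    (holomorphicM (holomorphic_shift _ _) (holomorphic_shift _ _)).
have HF0 : (H - F) @ (0 : V) --> H 0.
  rewrite -[X in _ --> X]subr0.
  exact: (cvgB (V := C) (holomorphic_continuous hH (0 : V)) F0).
have H0 : H 0 != 0 by rewrite expf_neq0 // add0r sub0r mulf_neq0.
have [u /=] := dense _ (cvgr_neq0 (V := C) _ HF0 H0).
move=> HFu u0; move: (FE u u0); rewrite /g eqxx /translate_ratio.
rewrite expr_div_n -exprM mul2n => /(divIf (expf_neq0 _ u0)) HF.
by move/eqP: HFu; apply; apply/eqP; rewrite subr_eq0; apply/eqP.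
Qed.

End GradedModule.

(** * Failure of finite generation *)

Theorem corollary2 (R : realType) (f : {poly Cplx R})
  (f_size : size f = 8%N) (f_lead : f`_7 = 4)
  (f_simple : forall a : Cplx R, ~~ (('X - a%:P) ^+ 2 %| f))
  (alpha beta : 'I_3 -> R -> Cplx R * Cplx R)
  (symp : symplectic_basis f alpha beta)
  (d' d'' : 'cV[int]_3)
  (riem : riemann_constant f alpha beta
            (tau alpha beta *m (2^-1 *: intvec d') + 2^-1 *: intvec d''))
  (sigma : 'cV[Cplx R]_3 -> Cplx R)
  (sigmaP : is_sigma f alpha beta d' d'' sigma) :
  ~ gr_finitely_generated (is_period alpha beta) sigma.
Proof.
case: sigmaP => holo_sigma sigma_qp sigma_exp.
have [a a0 Na0] := sigma_neq0_opp sigma_exp.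
apply: (@not_gr_finitely_generated _ _ _ holo_sigma _ _ _ a a0 Na0).
- exact: sigma0 sigma_exp.
- by move=> i; apply: partial_sigma0 => //; exact: holo_sigma.1.
- by move=> l; exact: sigma_automorphic sigma_qp.
- exact: sigma_neq0_near0.
Qed.
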